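(* Let $p$ be an odd prime and $r\ge 1$ an integer. For $n\ge 4$ consider the authentication code with source states $\mathbb{F}_{p^n}$, keys $\mathbb{F}_{p^n}$, messages $\mathbb{F}_{p^n}\times\mathbb{F}_p$ and encoding rules $E_k(s)=(s+k^{p^r},\operatorname{Tr}(sk))$. Then $P_S$ asymptotically meets the information-theoretic lower bound $P_S\ge 2^{H(\mathscr{E}|\mathscr{M}^2)-H(\mathscr{E}|\mathscr{M})}$, i.e. $$\lim_{n\to\infty}\frac{2^{H(\mathscr{E}|\mathscr{M}^2)-H(\mathscr{E}|\mathscr{M})}}{P_S}=1 .$$
   Context: $\operatorname{Tr}$ is the absolute trace from $\mathbb{F}_{p^n}$ to $\mathbb{F}_p$. The key $k\in\mathbb{F}_{p^n}$ is uniformly distributed and $\mathscr{E}$ denotes the random encoding rule $E_k$. $\mathscr{M}$ denotes the random message $E_k(s)=(s+k^{p^r},\operatorname{Tr}(sk))$ with $s$ uniform on $\mathbb{F}_{p^n}$ and independent of $k$. $\mathscr{M}^2$ denotes the pair of messages $(E_k(s_1),E_k(s_2))$ produced with the same key $k$, where $(s_1,s_2)$ is uniformly distributed over ordered pairs of distinct elements of $\mathbb{F}_{p^n}$ and is independent of $k$. $H(\cdot|\cdot)$ is conditional Shannon entropy in bits (logarithms base 2). The receiver holding key $k$ accepts a message $(m_1,m_2)$ iff $\operatorname{Tr}((m_1-k^{p^r})k)=m_2$. The maximum success probability of substitution attack (replacing an observed message $(m_1,m_2)$ by $(m_1',m_2')$ with $m_1'\ne m_1$) is $$P_S=\max_{\substack{\alpha\in\mathbb{F}_{p^n}\setminus\{0\},\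 a\in\mathbb{F}_{p^n}\\ b,\beta\in\mathbb{F}_p}}\frac{|\{x\in\mathbb{F}_{p^n}:\operatorname{Tr}(ax-x^{p^r+1})=b,\ \operatorname{Tr}(\alpha x)=\beta\}|}{|\{x\in\mathbb{F}_{p^n}:\operatorname{Tr}(ax-x^{p^r+1})=b\}|}.$$ *)

(* Defs.v *)
From HB Require Import structures.
From mathcomp Require Import all_boot all_order all_fingroup all_solvable all_algebra all_field.
From mathcomp Require Import classical_sets reals topology normedtype sequences exp.

Set Implicit Arguments.
Unset Strict Implicit.
Unset Printing Implicit Defensive.
Import Order.TTheory GRing.Theory Num.Theory.
Import numFieldNormedType.Exports.
Local Open Scope ring_scope.

Section FiniteProbability.
Variables (R : realType) (T : finType) (D : {set T}).

(* Probability of [E] when the outcome is uniform on [D]. *)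
Definition Pr (E : pred T) : R := #|[set w in D | E w]|%:R / #|D|%:R.

(* By the convention [x / 0 = 0], this is 0 when [C] has probability 0. *)
Definition condPr (E C : pred T) : R := Pr (predI E C) / Pr C.

Definition log2 (x : R) : R := ln x / ln 2.

(* Since [ln 0 = 0], events of probability 0 contribute 0. *)
Definition condEntropy (A B : finType) (X : T -> A) (Y : T -> B) : R :=
  - \sum_(y : B) \sum_(x : A)
      Pr [pred w | (X w == x) && (Y w == y)] *
      log2 (condPr [pred w | X w == x] [pred w | Y w == y]).

End FiniteProbability.

(* [F_{p^n}] is an extension field of ['F_p] of degree [n];
   [finvect_type] only adds the induced finite type structure. *)
Section AbsoluteTrace.
Variables (p : nat) (L : fieldExtType 'F_p).
Local Notation F := (finvect_type L).

(* [galTrace] takes its values in the copy ['F_p%:A] of the prime field inside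
   [F]; [absTr] is the same trace read in ['F_p], see [absTrE]. *)
Definition absTr (x : F) : 'F_p :=
  odflt 0 [pick c : 'F_p | c%:A == galTrace 1%VS fullv x :> F].

Lemma absTrE (x : F) : (absTr x)%:A = galTrace 1%VS fullv x :> F.
Proof.
rewrite /absTr; case: pickP => [c /eqP //|no_c].
have /vlineP[c cE] : galTrace 1%VS fullv x \in (1%VS : {vspace F}).
  by apply: (@mem_galTrace _ _ 1%AS {:F}%AS); rewrite ?memvf ?finField_galois ?subvf.
by have := no_c c; rewrite cE eqxx.
Qed.

Lemma absTr_frobenius (x : F) : prime p ->
  (absTr x)%:A = \sum_(i < \dim {:L}) x ^+ (p ^ i) :> F.
Proof.
move=> p_pr; rewrite absTrE.
have [a /eqP genG frobE] := finField_galois_generator (sub1v {:F}%AS).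
have ordG : #[a]%g = \dim {:L}.
  rewrite orderE -[LHS](congr1 (fun A : {set _} => #|A|) genG).
  rewrite -galois_dim ?dimv1 ?divn1 //.
  by rewrite finField_galois ?sub1v.
have powE i : (a ^+ i)%g x = x ^+ (p ^ i).
  elim: i => [|i IHi]; first by rewrite gal_id.
  rewrite expgSr galM ?memvf // IHi frobE ?memvf // -exprM dimv1 expn1.
  by rewrite card_Fp // expnSr.
rewrite /galTrace genG -ordG; under [RHS]eq_bigr do rewrite -powE.
have powI : injective (fun i : 'I_#[a]%g => (a ^+ i)%g).
  by move=> i j /eqP; rewrite eq_expg_ord // => /eqP.
rewrite -(big_imset (fun g : gal_of {:F} => g x) (in2W powI)) /=.
apply: eq_bigl => g; apply/idP/imsetP => [/cyclePmin[i lti ->]|[i _ ->]].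
  by exists (Ordinal lti).
exact: mem_cycle.
Qed.

Lemma absTrB (x y : F) : absTr (x - y) = absTr x - absTr y.
Proof.
apply: (fmorph_inj (in_alg F)).
by rewrite rmorphB /= !absTrE -raddfB.
Qed.

End AbsoluteTrace.

Section AuthenticationCode.
Variables (R : realType) (p r : nat) (L : fieldExtType 'F_p).
Local Notation F := (finvect_type L).

Definition message : finType := (F * 'F_p)%type.

Definition encode (k s : F) : message := (s + k ^+ (p ^ r), absTr (s * k)).

Definition encoding_rule (k : F) : {ffun F -> message} := [ffun s => encode k s].

Definition accepts (k : F) (m : message) : bool :=
  absTr ((m.1 - k ^+ (p ^ r)) * k) == m.2.

(* Outcomes [(k, s)]: key and source state uniform and independent. *)
Definition entropy_rule_message : R :=
  condEntropy R [set: F * F]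
    (fun w => encoding_rule w.1) (fun w => encoding_rule w.1 w.2).

(* Outcomes [(k, (s1, s2))] with [s1 != s2]. *)
Definition entropy_rule_message2 : R :=
  condEntropy R [set w : F * (F * F) | w.2.1 != w.2.2]
    (fun w => encoding_rule w.1)
    (fun w => (encoding_rule w.1 w.2.1, encoding_rule w.1 w.2.2)).

(* Greatest probability, over the observed message [m] and the message [m']
   put in its place, that the receiver accepts [m'] given that [m] was sent.
   All these probabilities are nonnegative, so that the default value 0 of the
   maximum is harmless. [P_SE] gives the explicit counting formula. *)
Definition P_S : R :=
  \big[Num.max/0]_(m : message) \big[Num.max/0]_(m' : message | m'.1 != m.1)
    condPr R [set: F * F] [pred w | accepts w.1 m']
                          [pred w | encode w.1 w.2 == m].

Lemma condPr_accepts (m m' : message) :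
  condPr R [set: F * F] [pred w | accepts w.1 m']
                        [pred w | encode w.1 w.2 == m] =
  #|[set x | accepts x m' && accepts x m]|%:R / #|[set x | accepts x m]|%:R.
Proof.
have cardE (Q : pred F) :
    #|[set w in [set: F * F] | Q w.1 && (encode w.1 w.2 == m)]| =
    #|[set x | Q x && accepts x m]|.
  pose g (x : F) : F * F := (x, m.1 - x ^+ (p ^ r)).
  have g_inj : injective g by move=> x y [].
  rewrite -(card_imset _ g_inj); apply: eq_card => -[k s].
  rewrite !inE /=; apply/andP/imsetP => [[Qk /eqP mE]|[x]].
    exists k; last by rewrite /g -mE /= addrK.
    by rewrite inE Qk /accepts -mE /= addrK eqxx.
  rewrite inE => /andP[Qx /eqP mE] [-> ->]; split=> //.
  by rewrite /encode subrK mE -surjective_pairing.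
have nz : #|[set: F * F]|%:R != 0 :> R.
  by rewrite pnatr_eq0 -lt0n; apply/card_gt0P; exists (0, 0); rewrite inE.
have c1 := cardE (fun k => accepts k m'); have c2 := cardE xpredT.
rewrite /condPr /Pr /= -c1 -[X in _ = _ / X%:R]c2 /=.
by rewrite invf_div mulrA divfK.
Qed.

Lemma acceptsE (k : F) (m : message) :
  accepts k m = (absTr (m.1 * k - k ^+ (p ^ r + 1)) == m.2).
Proof. by rewrite /accepts mulrBl -exprSr addn1. Qed.

Lemma P_SE :
  P_S = \big[Num.max/0]_(alpha : F | alpha != 0) \big[Num.max/0]_(a : F)
        \big[Num.max/0]_(b : 'F_p) \big[Num.max/0]_(beta : 'F_p)
    (#|[set x : F | (absTr (a * x - x ^+ (p ^ r + 1)) == b) &&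
                    (absTr (alpha * x) == beta)]|%:R /
     #|[set x : F | absTr (a * x - x ^+ (p ^ r + 1)) == b]|%:R).
Proof.
have P_SE1 m m' :
    condPr R [set: F * F] [pred w | accepts w.1 m']
                          [pred w | encode w.1 w.2 == m] =
    #|[set x : F | (absTr (m.1 * x - x ^+ (p ^ r + 1)) == m.2) &&
                   (absTr ((m'.1 - m.1) * x) == m'.2 - m.2)]|%:R /
    #|[set x : F | absTr (m.1 * x - x ^+ (p ^ r + 1)) == m.2]|%:R.
  rewrite condPr_accepts; congr (_%:R / _%:R); apply: eq_card => x.
    rewrite !inE !acceptsE andbC; apply: andb_id2l => /eqP <-.
    by rewrite [RHS]eq_sym subr_eq eq_sym mulrBl !absTrB addrA subrK.
  by rewrite !inE acceptsE.
apply/eqP; rewrite eq_le; apply/andP; split.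
  apply: bigmax_le => [|m _]; first exact: bigmax_ge_id.
  apply: bigmax_le => [|m' neq]; first exact: bigmax_ge_id.
  rewrite P_SE1; apply: (bigmax_sup (m'.1 - m.1)); first by rewrite subr_eq0.
  apply: (bigmax_sup m.1) => //; apply: (bigmax_sup m.2) => //.
  exact: (bigmax_sup (m'.2 - m.2)).
apply: bigmax_le => [|alpha alpha_neq0]; first exact: bigmax_ge_id.
apply: bigmax_le => [|a _]; first exact: bigmax_ge_id.
apply: bigmax_le => [|b _]; first exact: bigmax_ge_id.
apply: bigmax_le => [|beta _]; first exact: bigmax_ge_id.
apply: (bigmax_sup (a, b)) => //; apply: (bigmax_sup (alpha + a, beta + b)).
  by rewrite /= -subr_eq0 addrK.
by rewrite P_SE1 /= !addrK.
Qed.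

End AuthenticationCode.

(* Main.v *)
(* Let [q = #|F|].  If [f : F -> A] has few collisions [f (x + h) = f x], then
   [\sum_b (N b - q / #|A|) ^ 2] is small, where [N b] is the size of the fibre
   over [b].  For [f x = Tr (a x - x ^ (p ^ r + 1))] the difference
   [f (x + h) - f x] is affine in [x ^ (p ^ r)], and its linear part vanishes only
   for the at most [p ^ (2 r)] roots [h] of [h + h ^ (p ^ (2 r))]; adding the
   coordinate [Tr (alpha x)] changes nothing.  Hence the numbers of keys accepting
   one message, resp. two messages, are [q / p], resp. [q / p ^ 2], up to
   [p ^ r * sqrt q].  The key being uniform on these keys given the messages, both
   conditional entropies and [P_S] are determined up to a factor [1 + o(1)]. *)
Require Import Defs.
From HB Require Import structures.
From mathcomp Require Import all_boot all_order all_fingroup all_solvable all_algebra all_field.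
From mathcomp Require Import classical_sets reals topology normedtype sequences exp.
From mathcomp Require Import ring lra.
Set Implicit Arguments.
Unset Strict Implicit.
Unset Printing Implicit Defensive.

Import Order.TTheory GRing.Theory Num.Theory.
Import numFieldNormedType.Exports.
Local Open Scope ring_scope.

Lemma card_roots_lt (F : finFieldType) (P : {poly F}) :
  P != 0 -> (#|[set x : F | root P x]| < size P)%N.
Proof.
move=> P0; rewrite cardE; apply: max_poly_roots => //; last exact: enum_uniq.
by apply/allP => x; rewrite mem_enum inE.
Qed.

(** * The absolute trace: Frobenius invariance and equidistribution *)

Section Trace.
Variables (p : nat) (L : fieldExtType 'F_p).
Hypothesis p_prime : prime p.
Local Notation F := (finvect_type L).
Local Notation Tr := (@absTr p L).

Lemma card_finvect_Fp : #|F| = (p ^ \dim {:L})%N.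
Proof.
have := card_vspace {:F}%VS; rewrite card_Fp // => <-.
by apply: eq_card => x; rewrite memvf.
Qed.

Lemma absTr0 : Tr 0 = 0.
Proof. by rewrite -(subrr 0) absTrB subrr. Qed.

Lemma absTrN x : Tr (- x) = - Tr x.
Proof. by rewrite -sub0r absTrB absTr0 sub0r. Qed.

Lemma absTrD x y : Tr (x + y) = Tr x + Tr y.
Proof. by rewrite -[y in LHS]opprK absTrB absTrN opprK. Qed.

Lemma absTrMn x k : Tr (x *+ k) = Tr x *+ k.
Proof. by elim: k => [|k IHk]; rewrite ?absTr0 // !mulrS absTrD IHk. Qed.

Lemma pnat_pchar_finvect i : [pchar F].-nat (p ^ i)%N.
Proof.
rewrite pnatX; apply/orP; left; rewrite pnatE //.
by rewrite (pchar_lalg F) pchar_Fp.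
Qed.

(** Raising to the power [p ^ i] is additive and fixes the prime field, so it passes from the terms
    of the Frobenius sum to the whole trace and leaves it unchanged. *)
Lemma absTr_expp x i : Tr (x ^+ (p ^ i)) = Tr x.
Proof.
apply: (fmorph_inj (in_alg F)); rewrite /= !absTr_frobenius //.
transitivity ((Tr x)%:A ^+ (p ^ i) : F); last first.
  rewrite -absTr_frobenius //.
  have /= <- := rmorphXn (in_alg F) (p ^ i) (Tr x); congr (_%:A).
  elim: i => [|i IHi]; first by rewrite expr1.
  by rewrite expnSr exprM IHi -[RHS]expf_card card_Fp.
rewrite absTr_frobenius //.
elim/big_rec2: _ => [|j y1 y2 _ ->]; first by rewrite expr0n expn_eq0 eqn0Ngt prime_gt0.
by rewrite exprDn_pchar ?pnat_pchar_finvect // -!exprM mulnC.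
Qed.

(** Otherwise every field element would be a root of the nonzero polynomial [\sum_i 'X^(p ^ i)],
    whose degree is smaller than [#|F|]. *)
Lemma absTr_neq0 : exists x, Tr x != 0.
Proof.
apply/existsP; rewrite -[[exists x, _]]negbK negb_exists; apply/forallP => Tr_eq0.
have p_gt1 := prime_gt1 p_prime.
pose n := (\dim {:L}).-1; have nE : \dim {:L} = n.+1.
  exact: esym (prednK (adim_gt0 (aspacef L))).
pose P : {poly F} := \sum_(i < n.+1) 'X^(p ^ i).
have P_neq0 : P != 0.
  apply/eqP => /(congr1 (fun P : {poly F} => P`_1)).
  rewrite coef_sum coef0 (bigD1 ord0) //= coefXn eqxx big1 ?addr0.
    by move/eqP; rewrite oner_eq0.
  move=> i; rewrite -lt0n => i_gt0; rewrite coefXn.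
  by rewrite -(expn0 p) eqn_exp2l // eq_sym eqn0Ngt i_gt0.
have : (size P <= (p ^ n).+1)%N.
  apply: leq_trans (size_sum _ _ _) _; apply/bigmax_leqP => i _.
  by rewrite size_polyXn ltnS leq_exp2l // -ltnS.
move: (card_roots_lt P_neq0).
have -> : [set x : F | root P x] = [set: F].
  apply/setP => x; rewrite !inE rootE /P horner_sum.
  under eq_bigr do rewrite hornerXn.
  by rewrite -nE -absTr_frobenius // (eqP (negbNE (Tr_eq0 x))) scale0r eqxx.
rewrite cardsT card_finvect_Fp nE => lt1 lt2.
by have := leq_trans lt1 lt2; rewrite ltnS leq_exp2l // ltnn.
Qed.

Lemma absTr_surj c : exists x, Tr x = c.
Proof.
have [x Trx_neq0] := absTr_neq0.
by exists (x *+ val (c / Tr x)); rewrite absTrMn -mulr_natr natr_Zp mulrC divfK.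
Qed.

(** The fibres of a surjective additive map are translates of one another. *)
Lemma card_absTr_fiber (g : F) c : g != 0 ->
  (p * #|[set x : F | Tr (g * x)%R == c]|)%N = #|F|.
Proof.
move=> g_neq0.
have fiberE d : #|[set x : F | Tr (g * x) == d]| = #|[set x : F | Tr (g * x) == c]|.
  have [y Try] := absTr_surj (d - c).
  rewrite -[LHS](card_preimset _ (addIr (g^-1 * y))); apply: eq_card => z.
  rewrite !inE mulrDr mulVKf // absTrD Try.
  by rewrite addrCA -subr_eq0 addrAC subrr add0r subr_eq0.
rewrite -[RHS]sum1_card (partition_big (fun x => Tr (g * x)) xpredT) //=.
under eq_bigr do rewrite sum1dep_card fiberE.
by rewrite sum_nat_const card_Fp.
Qed.

End Trace.

(** * Bounds on conditional entropy *)

Section Probability.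
Variables (R : realType) (T : finType) (D : {set T}).

Lemma powR2_log2 (x : R) : 0 < x -> 2 `^ log2 x = x.
Proof.
move=> x_gt0; rewrite /powR pnatr_eq0 /= /log2 divfK ?lnK //.
by rewrite gt_eqF // ln_gt0 // ltr1n.
Qed.

Lemma log2_le (x y : R) : 0 < x -> x <= y -> log2 x <= log2 y.
Proof.
move=> x_gt0 xy; rewrite /log2 ler_wpM2r ?invr_ge0 ?ln_ge0 ?ler1n //.
by rewrite ler_ln // posrE // (lt_le_trans x_gt0).
Qed.

(* The outcome is determined by [X] and [Y], so that, given [Y], [X] is uniform
   on a set as large as the fibre of [Y]. *)
Lemma condEntropy_bounds (A B : finType) (X : T -> A) (Y : T -> B) (u v : R) :
  (0 < #|D|)%N -> 0 < u ->
  {in D &, forall w w', X w = X w' -> Y w = Y w' -> w = w'} ->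
  (forall w, w \in D -> u <= #|[set w' in D | Y w' == Y w]|%:R <= v) ->
  log2 u <= condEntropy R D X Y <= log2 v.
Proof.
move=> D_gt0 u_gt0 injXY card_fiber.
pose P x y := Pr R D [pred w | (X w == x) && (Y w == y)].
pose c x y := - log2 (condPr R D [pred w | X w == x] [pred w | Y w == y]).
have HE : condEntropy R D X Y = \sum_(y : B) \sum_(x : A) P x y * c x y.
  rewrite /condEntropy -sumrN; apply: eq_bigr => y _.
  by rewrite -sumrN; apply: eq_bigr => x _; rewrite /c mulrN.
have P_ge0 x y : 0 <= P x y by rewrite /P /Pr divr_ge0.
(* The joint law has total mass 1, so a constant is its own average; termwise bounds then give
   bounds on the entropy. *)
have P_sum (t : R) : t = \sum_(y : B) \sum_(x : A) P x y * t.
  under eq_bigr do rewrite -mulr_suml; rewrite -mulr_suml.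
  suff -> : \sum_(y : B) \sum_(x : A) P x y = 1 by rewrite mul1r.
  rewrite /P /Pr; under eq_bigr do rewrite -mulr_suml; rewrite -mulr_suml.
  apply: (canLR (mulfK _)); first by rewrite pnatr_eq0 -lt0n.
  rewrite mul1r; under eq_bigr do rewrite -natr_sum; rewrite -natr_sum; congr (_%:R).
  rewrite -[RHS]sum1_card (partition_big Y xpredT) //=; apply: eq_bigr => y _.
  rewrite (partition_big X xpredT) //=; apply: eq_bigr => x _.
  by rewrite sum1dep_card; apply: eq_card => w; rewrite !inE andbAC andbA.
have c_bounds x y : P x y != 0 -> log2 u <= c x y <= log2 v.
  rewrite /P /Pr mulf_eq0 negb_or pnatr_eq0 => /andP[+ _].
  rewrite -lt0n => /card_gt0P[w]; rewrite !inE => /and3P[wD /eqP Xw /eqP Yw].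
  suff -> : c x y = log2 #|[set w' in D | Y w' == Y w]|%:R.
    have /andP[le_u le_v] := card_fiber w wD.
    by rewrite !log2_le // (lt_le_trans u_gt0).
  rewrite /c /condPr /Pr /log2 -mulNr; congr (_ / _).
  (* By injectivity the joint event contains only [w], so the conditional probability is the inverse
     of the fibre size. *)
  have -> : [set w0 in D | predI [pred w | X w == x] [pred w | Y w == y] w0] = [set w].
    apply/setP => w'; rewrite !inE /= -Xw -Yw; apply/and3P/eqP => [[w'D /eqP Xw' /eqP Yw']|->].
      exact: injXY.
    by rewrite wD !eqxx.
  rewrite cards1 -Yw /= invf_div mulrA divfK ?pnatr_eq0 -?lt0n // mul1r.
  by rewrite lnV ?opprK // posrE (lt_le_trans u_gt0) //; case/andP: (card_fiber w wD).
rewrite HE [log2 u]P_sum [log2 v]P_sum; apply/andP; split;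
  apply: ler_sum => y _; apply: ler_sum => x _;
  have [->|Pxy] := eqVneq (P x y) 0; rewrite ?mul0r // ler_wpM2l //;
  by case/andP: (c_bounds x y Pxy).
Qed.

End Probability.

(** * Second-moment bound on fibre sizes *)

Section Fibers.
Variables (R : realType) (G : finZmodType) (A : finType) (f : G -> A).

(* The number of collisions of [f] is its second moment, so an excess of [E]
   collisions over the equidistributed value bounds the deviation of each fibre. *)
Lemma fiber_card_bound (E : R) (b : A) :
  (\sum_(h : G) #|[set x : G | f (x + h)%R == f x]|)%:R <= #|G|%:R ^+ 2 / #|A|%:R + E ->
  `|#|[set x : G | f x == b]|%:R - #|G|%:R / #|A|%:R| <= Num.sqrt E :> R.
Proof.
set q : R := #|G|%:R; set a : R := #|A|%:R => collisions.
pose N c : R := #|[set x : G | f x == c]|%:R.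
have a_neq0 : a != 0 by rewrite pnatr_eq0 -lt0n; apply/card_gt0P; exists b.
have sumN : \sum_c N c = q.
  rewrite -natr_sum; congr (_%:R); rewrite -[RHS]sum1_card (partition_big f xpredT) //=.
  by apply: eq_bigr => c _; rewrite sum1dep_card.
have sumN2 : \sum_c N c ^+ 2 = (\sum_(h : G) #|[set x : G | f (x + h)%R == f x]|)%:R.
  rewrite /N; under eq_bigr do rewrite -natrX; rewrite -natr_sum; congr (_%:R).
  (* Pairs [(x, y)] with the same image are grouped first by that image, then by the shift
     [h = y - x]. *)
  transitivity (\sum_(x : G) #|[set y : G | f y == f x]|)%N.
    rewrite [RHS](partition_big f xpredT) //=; apply: eq_bigr => c _.
    by rewrite (eq_bigr _ (fun x fx => congr1 (fun d => #|[set y : G | f y == d]|) (eqP fx)))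
      sum_nat_const cardsE mulnn.
  under [RHS]eq_bigr do rewrite -sum1dep_card big_mkcond /=.
  rewrite exchange_big /=; apply: eq_bigr => x _.
  rewrite -big_mkcond sum1dep_card -(card_imset _ (addrI x)).
  apply: eq_card => y; rewrite -[y in RHS](subrK x) [y - x + x]addrC.
  by rewrite mem_imset ?inE; [rewrite addrC subrK|exact: addrI].
(* The cross terms sum to [- 2 q ^ 2 / a] and the constants to [q ^ 2 / a], leaving the excess of
   collisions over [q ^ 2 / a]. *)
have dev : \sum_c (N c - q / a) ^+ 2 <= E.
  under eq_bigr do rewrite sqrrB.
  rewrite big_split sumrB /= sumN2 sumrMnl -mulr_suml sumN sumr_const.
  rewrite (_ : _ *+ #|A| = q ^+ 2 / a); last first.
    by rewrite -mulr_natr -/a expr2 mulf_div invfM; rewrite expr2 -!mulrA mulVf // mulr1.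
  rewrite mulrA -expr2 mulr2n opprD addrA subrK.
  by rewrite lerBlDl.
rewrite -sqrtr_sqr; apply: ler_wsqrtr; apply: le_trans dev.
by rewrite (bigD1 b) //= lerDl sumr_ge0 // => c _; rewrite sqr_ge0.
Qed.

End Fibers.

(** * Numbers of keys accepting one or two messages *)

Section KeyCounts.
Variables (R : realType) (p r : nat) (L : fieldExtType 'F_p).
Hypotheses (p_prime : prime p) (r_gt0 : (0 < r)%N).
Local Notation F := (finvect_type L).
Local Notation Tr := (@absTr p L).
Local Notation P := (p ^ r)%N.
Local Notation q := (#|F|%:R : R).

Let form (a x : F) : 'F_p := Tr (a * x - x ^+ (P + 1)).

Definition radical : {set F} := [set h | h + h ^+ (P * P) == 0].

(** The cross terms of [(x + h) ^+ (P + 1)] are [h * x ^+ P] and [h ^+ P * x]. Under the trace the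
    second equals [h ^+ (P * P) * x ^+ P], so both become linear in [x ^+ P]. *)
Lemma form_shift a x h :
  form a (x + h) = form a x + form a h - Tr ((h + h ^+ (P * P)) * x ^+ P).
Proof.
have hxE : Tr (h ^+ (P * P) * x ^+ P) = Tr (h ^+ P * x).
  by rewrite exprM -exprMn absTr_expp.
rewrite /form !addn1 !exprSr exprDn_pchar ?pnat_pchar_finvect //.
rewrite [(h + h ^+ _) * _]mulrDl (absTrD (h * _)) hxE -!absTrD -absTrB; congr (Tr _).
ring.
Qed.

Lemma card_radical : (#|radical| <= P * P)%N.
Proof.
(* Since [r] is positive, ['X^(P * P)] dominates ['X] and fixes the degree. *)
have PP_gt1 : (1 < P * P)%N by rewrite -expnD -(expn0 p) ltn_exp2l ?prime_gt1 ?addn_gt0 ?r_gt0.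
pose S : {poly F} := 'X^(P * P) + 'X.
have sizeS : size S = (P * P).+1.
  by rewrite size_polyDl ?size_polyXn // size_polyX ltnS.
have -> : radical = [set h | root S h].
  by apply/setP => h; rewrite !inE rootE !hornerE addrC.
by rewrite -ltnS -sizeS card_roots_lt // -size_poly_eq0 sizeS.
Qed.

Lemma frobenius_inj : injective (fun x : F => x ^+ P).
Proof.
move=> x y /= /eqP; rewrite -{1}(subrK y x) exprDn_pchar ?pnat_pchar_finvect //.
rewrite -subr_eq0 addrK expf_eq0 => /andP[_].
by rewrite subr_eq0 => /eqP.
Qed.

(** By [form_shift], a collision prescribes the value at [x ^+ P] of a nonzero trace functional, and
    [x ^+ P] runs over the whole field. *)
Lemma card_form_collision a h : h \notin radical ->
  (p * #|[set x : F | form a (x + h)%R == form a x]|)%N = #|F|.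
Proof.
rewrite inE => h_rad; rewrite -(card_absTr_fiber p_prime (form a h) h_rad).
congr (_ * _)%N; rewrite -[RHS](card_preimset _ frobenius_inj); apply: eq_card => x.
by rewrite !inE form_shift -addrA -[X in _ == X]addr0 (inj_eq (addrI _)) subr_eq0 eq_sym.
Qed.

Let p_neq0 : p%:R != 0 :> R.
Proof. by rewrite pnatr_eq0 -lt0n prime_gt0. Qed.

(** Shifts in the radical get the trivial bound [q]. The condition [C] on the shift alone lets one
    estimate serve both one message and two. *)
Let card_nonradical_le a h (C : pred F) :
  #|[set x : F | C h && (form a (x + h) == form a x)]|%:R
    <= (h \in radical)%:R * q + (C h)%:R * (q / p%:R) :> R.
Proof.
have q_div_p : 0 <= q / p%:R :> R by rewrite divr_ge0.
have [_|h_rad] := boolP (h \in radical).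
  rewrite mul1r (le_trans (y := q)) ?ler_nat ?max_card //.
  by rewrite lerDl mulr_ge0.
rewrite mul0r add0r; case: (C h); last first.
  by rewrite mul0r eq_card0 // => x; rewrite !inE.
rewrite mul1r ler_pdivlMr ?ltr0n ?prime_gt0 // -natrM mulnC ler_nat.
by rewrite -(card_form_collision a h_rad).
Qed.

Let sum_collision_le (C : pred F) a :
  (\sum_(h : F) #|[set x : F | C h && (form a (x + h)%R == form a x)]|)%:R
    <= #|[set h | C h]|%:R * (q / p%:R) + (P * P * #|F|)%:R :> R.
Proof.
rewrite natr_sum.
apply: (@le_trans _ _ (\sum_(h : F) ((h \in radical)%:R * q + (C h)%:R * (q / p%:R)))).
  by apply: ler_sum => h _; exact: card_nonradical_le.
rewrite big_split /= -!mulr_suml -!natr_sum -!big_mkcond !sum1dep_card addrC.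
by rewrite lerD2l natrM ler_wpM2r // ler_nat cardsE card_radical.
Qed.

Lemma card_accepts_bound (m : message L) :
  `|#|[set x | accepts r x m]|%:R - q / p%:R|
    <= Num.sqrt (P * P * #|F|)%:R :> R.
Proof.
under eq_finset do rewrite acceptsE.
have -> : q / p%:R = q / #|{: 'F_p}|%:R by rewrite card_Fp.
apply: fiber_card_bound.
apply: le_trans (sum_collision_le xpredT m.1) _.
by rewrite lerD2r card_Fp // cardsT expr2 mulrA.
Qed.

(** A collision in the second coordinate of [f] depends only on the shift [h] and holds for [q / p]
    of the shifts, which turns the main term into [q ^ 2 / p ^ 2]. *)
Lemma card_accepts2_bound (m m' : message L) : m'.1 != m.1 ->
  `|#|[set x | accepts r x m' && accepts r x m]|%:R - q / (p ^ 2)%:R|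
    <= Num.sqrt (P * P * #|F|)%:R :> R.
Proof.
move=> neq; pose d := m'.1 - m.1; have d_neq0 : d != 0 by rewrite subr_eq0.
pose f x := (form m.1 x, Tr (d * x)).
have -> : [set x | accepts r x m' && accepts r x m] =
    [set x | f x == (m.2, m'.2 - m.2)].
  apply/setP => x; rewrite !inE !acceptsE andbC xpair_eqE.
  apply: andb_id2l => /eqP <-.
  by rewrite [RHS]eq_sym subr_eq eq_sym mulrBl !absTrB addrA subrK.
have cardFp2 : (p ^ 2)%N = #|(('F_p * 'F_p)%type : finType)|.
  by rewrite card_prod card_Fp // mulnn.
rewrite cardFp2; apply: fiber_card_bound; rewrite -cardFp2.
have fE h : [set x | f (x + h) == f x] =
    [set x | (Tr (d * h) == 0) && (form m.1 (x + h) == form m.1 x)].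
  apply/setP => x; rewrite !inE xpair_eqE andbC; congr (_ && _).
  by rewrite mulrDr absTrD // addrC -subr_eq0 addrK.
under eq_bigr do rewrite fE.
apply: le_trans (sum_collision_le (fun h => Tr (d * h) == 0) m.1) _.
rewrite lerD2r -(card_absTr_fiber p_prime 0 d_neq0) !natrM.
by rewrite le_eqVlt; apply/orP; left; apply/eqP; field; exact: p_neq0.
Qed.

End KeyCounts.

Lemma sqrtrX (R : rcfType) (x : R) k : 0 <= x -> Num.sqrt (x ^+ k) = Num.sqrt x ^+ k.
Proof.
by move=> x_ge0; elim: k => [|k IHk]; rewrite ?sqrtr1 // !exprS sqrtrM // IHk.
Qed.

(** * Entropies and substitution probability of the code *)

Section Code.
Variables (R : realType) (p r : nat) (L : fieldExtType 'F_p).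
Local Notation F := (finvect_type L).
Local Notation P := (p ^ r)%N.

(** The encoding of the source state 0 has first component [k ^+ P], which determines the key; so
    uncertainty about the rule is uncertainty about the key. *)
Lemma encoding_rule_inj (p_prime : prime p) : injective (@encoding_rule p r L).
Proof.
move=> k k' /ffunP /(_ 0); rewrite !ffunE => -[+ _]; rewrite !add0r.
exact: (frobenius_inj p_prime).
Qed.

Lemma encode_accepts k s (m : message L) :
  (encode r k s == m) = (s == m.1 - k ^+ P) && accepts r k m.
Proof.
case: m => m1 m2; rewrite /encode /accepts xpair_eqE /=.
have -> : (s == m1 - k ^+ P) = (s + k ^+ P == m1) by rewrite eq_sym subr_eq eq_sym.
by apply: andb_id2l => /eqP <-; rewrite addrK.
Qed.

(** Key and message determine the source state, so the outcomes producing [m] biject with the keys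
    accepting [m]. *)
Lemma entropy_rule_message_bounds (u v : R) : prime p -> 0 < u ->
  (forall m : message L, u <= #|[set x | accepts r x m]|%:R <= v) ->
  log2 u <= entropy_rule_message R r L <= log2 v.
Proof.
move=> p_prime u_gt0 bounds; apply: condEntropy_bounds => //.
- by apply/card_gt0P; exists (0, 0); rewrite inE.
- move=> [k s] [k' s'] _ _ /= /(encoding_rule_inj p_prime) <-.
  by rewrite !ffunE => -[/addIr -> _].
move=> [k s] _ /=; set m := encoding_rule r k s.
rewrite (_ : #|_| = #|[set x | accepts r x m]|); first exact: bounds.
have inj : injective (fun x : F => (x, m.1 - x ^+ P)) by move=> x y [].
rewrite -[RHS](card_imset _ inj); apply: eq_card => -[x y]; rewrite !inE /= ffunE encode_accepts.
apply/andP/imsetP => [[/eqP -> acc]|[z + [-> ->]]]; first by exists x; rewrite ?inE.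
by rewrite inE ?eqxx.
Qed.

Lemma entropy_rule_message2_bounds (u v : R) : prime p -> 0 < u ->
  (forall m m' : message L, m'.1 != m.1 ->
    u <= #|[set x | accepts r x m' && accepts r x m]|%:R <= v) ->
  log2 u <= entropy_rule_message2 R r L <= log2 v.
Proof.
move=> p_prime u_gt0 bounds; apply: condEntropy_bounds => //.
- by apply/card_gt0P; exists (0, (0, 1)); rewrite inE /= eq_sym oner_neq0.
- move=> [k [s1 s2]] [k' [s1' s2']] _ _ /= /(encoding_rule_inj p_prime) <-.
  by rewrite !ffunE => -[/addIr -> _ /addIr -> _].
move=> [k [s1 s2]]; rewrite inE /= => neq.
set m := encoding_rule r k s1; set m' := encoding_rule r k s2.
have neqm : m'.1 != m.1.
  by rewrite /m /m' !ffunE /= (inj_eq (addIr _)) eq_sym.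
rewrite (_ : #|_| = #|[set x | accepts r x m' && accepts r x m]|); first exact: bounds.
have inj : injective (fun x : F => (x, (m.1 - x ^+ P, m'.1 - x ^+ P))) by move=> x y [].
rewrite -[RHS](card_imset _ inj); apply: eq_card => -[x [y y']].
rewrite !inE /= xpair_eqE !ffunE !encode_accepts.
apply/andP/imsetP => [[_ /andP[/andP[/eqP -> acc] /andP[/eqP -> acc']]]|[z + [-> -> ->]]].
  by exists x; rewrite ?inE ?acc ?acc'.
by rewrite inE /= => /andP[-> ->]; rewrite ?eqxx; rewrite (inj_eq (addIr _)) eq_sym.
Qed.

Lemma P_S_bounds (u1 v1 u2 v2 : R) : 0 < u1 -> 0 < u2 ->
  (forall m : message L, u1 <= #|[set x | accepts r x m]|%:R <= v1) ->
  (forall m m' : message L, m'.1 != m.1 ->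
    u2 <= #|[set x | accepts r x m' && accepts r x m]|%:R <= v2) ->
  u2 / v1 <= P_S R r L <= v2 / u1.
Proof.
move=> u1_gt0 u2_gt0 bounds1 bounds2.
pose ratio (m m' : message L) : R :=
  #|[set x | accepts r x m' && accepts r x m]|%:R / #|[set x | accepts r x m]|%:R.
have ratio_bounds m m' : m'.1 != m.1 -> u2 / v1 <= ratio m m' <= v2 / u1.
  move=> neq; have /andP[l1 h1] := bounds1 m; have /andP[l2 h2] := bounds2 m m' neq.
  have N1_gt0 := lt_le_trans u1_gt0 l1; have v1_gt0 := lt_le_trans N1_gt0 h1.
  by rewrite /ratio; apply/andP; split; apply: ler_pM;
    rewrite ?invr_ge0 ?lef_pV2 ?posrE // ltW.
(* Any admissible pair bounds the maximum from below; this one also shows [0 <= v2 / u1], as the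
   default value 0 requires. *)
have neq10 : ((1, 0) : message L).1 != ((0, 0) : message L).1 by exact: oner_neq0.
have upper_ge0 : 0 <= v2 / u1.
  by have /andP[_] := ratio_bounds _ _ neq10; apply: le_trans; rewrite divr_ge0.
rewrite /P_S; apply/andP; split.
  apply: (bigmax_sup ((0, 0) : message L)) => //.
  apply: (bigmax_sup ((1, 0) : message L)) => //.
  by rewrite condPr_accepts; case/andP: (ratio_bounds _ _ neq10).
apply: bigmax_le => // m _; apply: bigmax_le => // m' neq.
by rewrite condPr_accepts; case/andP: (ratio_bounds _ _ neq).
Qed.

(* With [q = #|F|], the relative error [p ^ (r + 2) / sqrt q] covers both the
   deviation from [q / p] and the one from [q / p ^ 2]. *)
Definition rel_error : R := (p ^ (r + 2))%:R / Num.sqrt #|F|%:R.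

(** Numerator and denominator both lie between [u2 / v1] and [v2 / u1]; the quotient of these two
    ends is a square. *)
Lemma ratio_bounds : prime p -> (0 < r)%N -> rel_error < 1 ->
  ((1 - rel_error) / (1 + rel_error)) ^+ 2 <=
    2 `^ (entropy_rule_message2 R r L - entropy_rule_message R r L) / P_S R r L
  <= ((1 + rel_error) / (1 - rel_error)) ^+ 2.
Proof.
move=> p_prime r_gt0; set e := rel_error => e_lt1.
set q : R := #|F|%:R.
have q_gt0 : 0 < q by rewrite ltr0n; apply/card_gt0P; exists 0.
have p_gt0 : 0 < p%:R :> R by rewrite ltr0n prime_gt0.
have p_ge1 : 1 <= p%:R :> R by rewrite ler1n prime_gt0.
have e_ge0 : 0 <= e by rewrite divr_ge0 ?sqrtr_ge0.
have sqrtE : Num.sqrt (P * P * #|F|)%:R = e * q / p%:R ^+ 2 :> R.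
  rewrite natrM sqrtrM // natrM -expr2 sqrtr_sqr ger0_norm // /e /rel_error.
  rewrite -/q expnD !natrM !natrX -[X in _ = _ * X / _](sqr_sqrtr (ltW q_gt0)).
  by field; rewrite !gt_eqF ?sqrtr_gt0.
pose u1 := q / p%:R * (1 - e); pose v1 := q / p%:R * (1 + e).
pose u2 := q / p%:R ^+ 2 * (1 - e); pose v2 := q / p%:R ^+ 2 * (1 + e).
(* The error is calibrated to [q / p ^ 2]; relative to the larger [q / p] it is at most [e] as
   well. *)
have dev_le : e * q / p%:R ^+ 2 <= e * (q / p%:R).
  rewrite -mulrA ler_wpM2l // ler_wpM2l ?(ltW q_gt0) // lef_pV2 ?posrE ?exprn_gt0 //.
  by rewrite expr2 ler_peMr // (ltW p_gt0).
have bounds1 (m : message L) : u1 <= #|[set x | accepts r x m]|%:R <= v1.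
  have := card_accepts_bound R p_prime r_gt0 m.
  rewrite sqrtE -/q ler_distl => /andP[l h]; rewrite /u1 /v1 !mulrDr mulr1 mulrN.
  rewrite [_ * e]mulrC; apply/andP; split; lra.
have bounds2 (m m' : message L) : m'.1 != m.1 ->
    u2 <= #|[set x | accepts r x m' && accepts r x m]|%:R <= v2.
  move=> neq; have := card_accepts2_bound R p_prime r_gt0 neq.
  rewrite sqrtE -/q natrX ler_distl => /andP[l h]; rewrite /u2 /v2 !mulrDr mulr1 mulrN.
  rewrite [_ * e]mulrC mulrA; apply/andP; split; lra.
have e1_gt0 : 0 < 1 - e by lra.
have e2_gt0 : 0 < 1 + e by lra.
have [u1_gt0 v1_gt0] : 0 < u1 /\ 0 < v1 by rewrite !mulr_gt0 ?invr_gt0.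
have [u2_gt0 v2_gt0] : 0 < u2 /\ 0 < v2 by rewrite !mulr_gt0 ?invr_gt0 ?exprn_gt0.
have /andP[PSl PSh] := P_S_bounds u1_gt0 u2_gt0 bounds1 bounds2.
have PS_gt0 : 0 < P_S R r L by apply: lt_le_trans PSl; rewrite divr_gt0.
have /andP[H1l H1h] := entropy_rule_message_bounds p_prime u1_gt0 bounds1.
have /andP[H2l H2h] := entropy_rule_message2_bounds p_prime u2_gt0 bounds2.
have pow_log (x y : R) : 0 < x -> 0 < y -> 2 `^ (log2 x - log2 y) = x / y.
  move=> x0 y0; rewrite powRD; last by rewrite pnatr_eq0 implybT.
  by rewrite powRN !powR2_log2.
have powl : u2 / v1 <= 2 `^ (entropy_rule_message2 R r L - entropy_rule_message R r L).
  by rewrite -pow_log // ler_powR ?ler1n // lerB.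
have powh : 2 `^ (entropy_rule_message2 R r L - entropy_rule_message R r L) <= v2 / u1.
  by rewrite -pow_log // ler_powR ?ler1n // lerB.
have -> : ((1 - e) / (1 + e)) ^+ 2 = (u2 / v1) / (v2 / u1).
  by rewrite /u1 /u2 /v1 /v2; field; rewrite !gt_eqF.
have -> : ((1 + e) / (1 - e)) ^+ 2 = (v2 / u1) / (u2 / v1).
  by rewrite /u1 /u2 /v1 /v2; field; rewrite !gt_eqF.
have ratio1_gt0 : 0 < u2 / v1 by rewrite divr_gt0.
have ratio2_gt0 : 0 < v2 / u1 by rewrite divr_gt0.
by apply/andP; split; apply: ler_pM;
  rewrite ?powR_ge0 ?invr_ge0 ?lef_pV2 ?posrE // ltW.
Qed.

End Code.

(** * Passage to the limit *)

Local Open Scope classical_set_scope.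

Theorem theorem5 (R : realType) (p r : nat) (p_prime : prime p) (p_odd : odd p)
    (r_ge1 : (1 <= r)%N) (L : nat -> fieldExtType 'F_p)
    (degL : forall n : nat, (4 <= n)%N -> \dim {:L n} = n) :
  (fun n : nat =>
     2 `^ (entropy_rule_message2 R r (L n) - entropy_rule_message R r (L n))
       / P_S R r (L n) : R) @ \oo --> (1 : R).
Proof.
pose e n : R := rel_error R r (L n).
have e_cvg0 : e n @[n --> \oo] --> (0 : R).
  pose z : R := (Num.sqrt p%:R)^-1.
  have z_lt1 : `|z| < 1.
    rewrite ger0_norm ?invr_ge0 ?sqrtr_ge0 // invf_lt1 ?sqrtr_gt0 ?ltr0n ?prime_gt0 //.
    by rewrite -[ltLHS]sqrtr1 ltr_sqrt ?ltr0n ?prime_gt0 // ltr1n prime_gt1.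
  have cvgz : (p ^ (r + 2))%:R * z ^+ n @[n --> \oo] --> (0 : R).
    rewrite -[0](mulr0 (p ^ (r + 2))%:R); apply: cvgMr.
    exact: cvg_expr.
  (* As [#|F| = p ^ n] once [4 <= n], the error [e n] is eventually this geometric sequence. *)
  apply: cvg_trans cvgz; apply: near_eq_cvg; near=> n.
  rewrite /e /rel_error card_finvect_Fp // degL; last by near: n; exact: nbhs_infty_ge.
  by rewrite !natrX sqrtrX // exprVn.
have one_pm (s : R) : 1 + s * e n @[n --> \oo] --> (1 : R).
  rewrite -[X in _ --> X]addr0 -[X in _ + X](mulr0 s).
  apply: cvgD; first exact: cvg_cst.
  by apply: cvgM => //; exact: cvg_cst.
have cvg_quot (s t : R) : ((1 + s * e n) / (1 + t * e n)) ^+ 2 @[n --> \oo] --> (1 : R).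
  have quot1 : (1 + s * e n) / (1 + t * e n) @[n --> \oo] --> (1 : R).
    rewrite -[X in _ --> X]divr1; apply: cvgM; first exact: one_pm.
    by apply: cvgV; [exact: oner_neq0|exact: one_pm].
  by rewrite -[X in _ --> X]mulr1; exact: cvgM.
apply: (squeeze_cvgr _ (cvg_quot (-1) 1) (cvg_quot 1 (-1))); near=> n.
rewrite !mulN1r !mul1r; apply: ratio_bounds => //.
near: n; exact: (cvgr_lt 0 e_cvg0).
Unshelve. all: by end_near. Qed.
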